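(* Let $p$ be a prime, let $s,r\ge1$ be integers, $q=p^r$, and let $m$ be a positive integer such that $rm\ge s$; put $n=q^m-1$. Let $L=GR(p^s,r)$ and let $\xi$ be a primitive element of $\mathcal{R}=GR(p^s,rm)$. Let $\mathcal{K}^-$ and $\mathcal{K}$ be the shortened Kerdock code (length $n$) and the Kerdock code (length $n+1=q^m$) over $L$ associated with $\xi$, and let $T:\mathcal{R}\to L$ be the relative trace. Write $1^k$ for the all-one tuple of length $k$. Then $\mathcal{K}^-$ and $\mathcal{K}$ have the following trace descriptions over $\mathcal{R}$: 1. $\mathcal{K}^-=\{\epsilon 1^n+v^{(\lambda)}\mid \epsilon\in L,\ \lambda\in\mathcal{R}\}$, where $v^{(\lambda)}=(T(\lambda),T(\lambda\xi),T(\lambda\xi^2),\dots,T(\lambda\xi^{n-1}))$; 2. $\mathcal{K}=\{\epsilon 1^{n+1}+u^{(\lambda)}\mid \epsilon\in L,\ \lambda\in\mathcal{R}\}$, where $u^{(\lambda)}=(0,T(\lambda),T(\lambda\xi),T(\lambda\xi^2),\dots,T(\lambda\xi^{n-1}))$.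
   Context: $GR(p^s,r)$ denotes the Galois ring of characteristic $p^s$ with $p^{sr}$ elements; its residue field is $\mathbb{F}_q$. Let $h(x)\in L[x]$ be a monic basic primitive polynomial of degree $m$ (i.e. its reduction mod $p$ is a primitive polynomial over $\mathbb{F}_q$) dividing $x^n-1$ and having $\xi$ as a root of multiplicative order $n$ in $\mathcal{R}=L[x]/(h(x))=GR(p^s,rm)$; such a $\xi$ is called a primitive element of $\mathcal{R}$. Every $c\in\mathcal{R}$ has a unique $p$-adic representation $c=\xi_0+p\xi_1+\dots+p^{s-1}\xi_{s-1}$ with $\xi_i\in\{0,1,\xi,\dots,\xi^{n-1}\}$. The Frobenius automorphism $f$ of $\mathcal{R}$ over $L$ is $c\mapsto c^f=\xi_0^q+p\xi_1^q+\dots+p^{s-1}\xi_{s-1}^q$; it has order $m$ and fixed ring $L$. The relative trace is $T(c)=c+c^f+c^{f^2}+\dots+c^{f^{m-1}}$. The reciprocal polynomial of a polynomial $a(x)$ of degree $d$ is $x^d a(1/x)$. Let $g(x)$ be the reciprocal polynomial of $(x^n-1)/((x-1)h(x))$. The shortened Kerdock code $\mathcal{K}^-$ is the cyclic code of length $n$ over $L$ with generator polynomial $g(x)$, i.e. the set of $(c_0,\dots,c_{n-1})\in L^n$ such that $c_0+c_1x+\dots+c_{n-1}x^{n-1}$ lies in the ideal generated by $g(x)$ in $L[x]/(x^n-1)$. The Kerdock code $\mathcal{K}$ of length $q^m$ is obtained by adding an overall parity check in the first position: $\mathcal{K}=\{(c_\infty,c_0,\dots,c_{n-1})\mid (c_0,\dots,c_{n-1})\in\mathcal{K}^-,\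 c_\infty+c_0+\dots+c_{n-1}=0\}$. *)

(* Defs.v *)
From HB Require Import structures.
From mathcomp Require Import all_boot all_order all_algebra all_field.

Set Implicit Arguments.
Unset Strict Implicit.
Unset Printing Implicit Defensive.

Import GRing.Theory.
Local Open Scope ring_scope.

(* L is a Galois ring GR(p^s, r): a finite commutative ring of characteristic
   p^s with p^(s*r) elements, whose zero divisors (0 included) are exactly the
   elements of the principal ideal pL. *)
Definition galois_ring (p s r : nat) (L : finComNzRingType) : Prop :=
  [/\ prime p,
      forall k : nat, (k%:R == 0 :> L) = (p ^ s %| k)%N,
      #|L| = (p ^ (s * r))%N
    & forall x : L, (exists2 y : L, y != 0 & x * y = 0)
                    <-> (exists z : L, x = p%:R * z)].

(* pi presents F as the residue field L/pL. *)
Definition residue_map (p : nat) (L : finComNzRingType) (F : finFieldType)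
    (pi : {rmorphism L -> F}) : Prop :=
  (forall y : F, exists x : L, pi x = y)
  /\ (forall x : L, pi x = 0 <-> exists z : L, x = p%:R * z).

Definition basic_primitive (L : finComNzRingType) (F : finFieldType)
    (pi : {rmorphism L -> F}) (h : {poly L}) : Prop :=
  h \is monic /\ primitive_poly (map_poly pi h).

Section Trace.
Variables (R : comNzRingType) (p s q n m : nat) (xi : R).

(* The Teichmuller set {0, 1, xi, ..., xi^(n-1)}, indexed by option 'I_n. *)
Definition teichmuller (d : option 'I_n) : R :=
  if d is Some i then xi ^+ i else 0.

Definition padic_repr (c : R) (d : {ffun 'I_s -> option 'I_n}) : bool :=
  c == \sum_(i < s) p%:R ^+ i * teichmuller (d i).

(* In a Galois ring with primitive element xi every c has exactly one p-adic
   representation, so the choice made by pick is forced and the default value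
   0 is never reached. *)
Definition frobenius (c : R) : R :=
  if [pick d | padic_repr c d] is Some d
  then \sum_(i < s) p%:R ^+ i * teichmuller (d i) ^+ q else 0.

(* The trace is computed inside R; its values lie in the fixed ring of
   frobenius, that is, in the copy of L contained in R. *)
Definition trace (c : R) : R := \sum_(i < m) iter i frobenius c.

Definition trace_row (lambda : R) : 'rV[R]_n :=
  \row_(i < n) trace (lambda * xi ^+ i).

End Trace.

(* x^d a(1/x), where d is the degree of a. *)
Definition reciprocal (L : nzRingType) (a : {poly L}) : {poly L} :=
  \poly_(i < size a) a`_((size a).-1 - i).

(* rdivp is Euclidean division, the divisor being monic when h is. *)
Definition kerdock_gen (L : finComNzRingType) (n : nat) (h : {poly L}) :
    {poly L} :=
  reciprocal (Pdiv.Ring.rdivp ('X^n - 1) (('X - 1) * h)).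

(* The cyclic code of length n generated by g; the word c is identified with
   the class of c_0 + c_1 x + ... + c_(n-1) x^(n-1). For n > 0 the polynomial
   'X^n - 1 is monic of positive degree, as {poly %/ _} requires. *)
Definition cyclic_code (L : finComNzRingType) (n : nat) (g : {poly L}) :
    {set 'rV[L]_n} :=
  [set c | [exists u : {poly %/ ('X^n - 1 : {poly L})},
      in_qpoly ('X^n - 1) (rVpoly c) == u * in_qpoly ('X^n - 1) g]].

Definition shortened_kerdock (L : finComNzRingType) (n : nat) (h : {poly L}) :
    {set 'rV[L]_n} :=
  cyclic_code n (kerdock_gen n h).

(* The first coordinate is c_oo. *)
Definition kerdock (L : finComNzRingType) (n : nat) (h : {poly L}) :
    {set 'rV[L]_(1 + n)} :=
  [set c | (rsubmx c \in shortened_kerdock n h)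
           && (lsubmx c 0 0 + \sum_(i < n) rsubmx c 0 i == 0)].

(* L^k viewed inside R^k, for R = L[x]/(h), through the constant classes. *)
Definition extend_scalars (L : finComNzRingType) (h : {poly L}) (k : nat)
    (C : {set 'rV[L]_k}) : {set 'rV[{poly %/ h}]_k} :=
  [set map_mx (qpolyC h) c | c in C].

(* Main.v *)
(* Reduction modulo p maps R = L[x]/(h) onto the field K = F_q[x]/(h mod p), and
   the Teichmuller set {0, 1, xi, ..., xi^(n-1)} bijectively onto K: elements
   fixed by x |-> x^(q^m) that are congruent mod p are equal, because congruence
   mod p improves to congruence mod p^(k+1) after raising to the power p^k.
   Since x^n - 1 is separable mod p, x |-> x^q permutes the roots of h, so
   substituting x^q for x defines a ring endomorphism of R over L; it agrees
   with the q-th power on the Teichmuller set and hence is the Frobenius map,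
   which is thus additive, of order m, with fixed ring L.  The trace is then
   L-linear, L-valued, and nondegenerate (mod p it is a polynomial of degree
   q^(m-1) < |K|).

   The words eps 1^n + v^(lambda) are annihilated by the reciprocal of (x-1)h,
   since 1 and xi are roots of (x-1)h; so they all lie in K^-.  There are
   |L||R| = |L|^(m+1) of them, and a cyclic code with a check polynomial of
   degree m+1 has at most |L|^(m+1) words, so K^- contains nothing else.  As
   the entries of v^(lambda) sum to 0 and n = -1 in L (this is where s <= rm is
   used), the parity check of eps 1^n + v^(lambda) is eps. *)

Require Import Defs.
From HB Require Import structures.
From mathcomp Require Import all_boot all_order all_algebra all_field.
From mathcomp Require Import zify.

Set Implicit Arguments.
Unset Strict Implicit.
Unset Printing Implicit Defensive.

Import GRing.Theory.
Local Open Scope ring_scope.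

(** * Finite chain rings over their residue field *)

(* rho presents K as the residue field of a chain ring B with nonzero ideals
   p^i B, i < s: the last condition says that no element outside p B is killed
   by p^i with i < s. *)
Definition chain_residue (p s : nat) (B : comNzRingType) (K : fieldType)
    (rho : {rmorphism B -> K}) : Prop :=
  [/\ forall x, rho x = 0 <-> exists z, x = p%:R * z,
      p%:R ^+ s = 0 :> B
    & forall i x, (i < s)%N -> p%:R ^+ i * x = 0 -> rho x = 0].

Section ChainRing.
Variables (p s : nat) (B : comNzRingType) (K : fieldType).
Variables (rho : {rmorphism B -> K}) (chB : chain_residue p s rho).

Lemma chain_residue_p : rho p%:R = 0.
Proof. by case: chB => kerP _ _; apply/kerP; exists 1; rewrite mulr1. Qed.

(** Factors [p] are split off as long as the cofactor lies in the kernel of [rho]; as [p^s = 0], a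
    nonzero [x] allows fewer than [s] of them. *)
Lemma chain_valuation (x : B) :
  x != 0 -> exists k u, [/\ (k < s)%N, x = p%:R ^+ k * u & rho u != 0].
Proof.
case: chB => kerP ps0 _ nz_x.
suff val_x j : (exists k u, [/\ (k < j)%N, x = p%:R ^+ k * u & rho u != 0])
    \/ exists u, x = p%:R ^+ j * u.
  case: (val_x s) => // -[u def_x].
  by move: nz_x; rewrite def_x ps0 mul0r eqxx.
elim: j => [|j [[k [u [ltkj def_x u_neq0]]]|[u def_x]]].
- by right; exists x; rewrite mul1r.
- by left; exists k, u; split=> //; apply: ltnW.
have [/kerP[z def_u]|u_neq0] := eqVneq (rho u) 0.
  by right; exists z; rewrite def_x def_u mulrA exprSr.
by left; exists j, u; split.
Qed.

(** If [y = p^k u] with [rho u] nonzero, then [p^k] kills [x u], whose residue is nonzero. *)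
Lemma chain_regular (x y : B) : rho x != 0 -> x * y = 0 -> y = 0.
Proof.
case: (chB) => _ _ tor x_neq0 xy0.
apply/eqP/contraT => /chain_valuation[k [u [ltks def_y u_neq0]]].
have /(tor _ _ ltks)/eqP : p%:R ^+ k * (x * u) = 0 by rewrite mulrCA -def_y.
by rewrite rmorphM mulf_eq0 (negPf x_neq0) (negPf u_neq0).
Qed.

Lemma chain_congr_expn (x y : B) k :
  rho x = rho y -> exists z, x ^+ (p ^ k) - y ^+ (p ^ k) = p%:R ^+ k.+1 * z.
Proof.
case: (chB) => kerP _ _ eq_xy; elim: k => [|k [z IHk]].
  by apply/kerP; rewrite !expr1 rmorphB /= eq_xy subrr.
set X := x ^+ _ in IHk; set Y := y ^+ _ in IHk.
(* The cofactor of [X - Y] in [X^p - Y^p] reduces to [p] equal terms, so it supplies one more factor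
   [p]. *)
have /kerP[w def_w]: rho (\sum_(i < p) X ^+ (p.-1 - i) * Y ^+ i) = 0.
  rewrite rmorph_sum /= (eq_bigr (fun=> rho X ^+ p.-1)) => [|i _].
    by rewrite sumr_const card_ord -mulr_natr -(rmorph_nat rho)
      chain_residue_p mulr0.
  rewrite rmorphM !rmorphXn /= eq_xy -exprD subnK //.
  by rewrite -ltnS (ltn_predK (ltn_ord i)).
exists (z * w).
by rewrite expnSr !exprM subrXX -/X -/Y IHk def_w [in RHS]exprSr mulrACA mulrA.
Qed.

(** The power [p^(d s)] fixes [x] and [y] and makes their difference a multiple of [p^(d s + 1)],
    which is zero since [d > 0]. *)
Lemma chain_fixed_expn_inj (x y : B) d : (0 < d)%N ->
  x ^+ (p ^ d) = x -> y ^+ (p ^ d) = y -> rho x = rho y -> x = y.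
Proof.
case: (chB) => _ ps0 _ d_gt0 fix_x fix_y eq_xy.
have iter_fix t : t ^+ (p ^ d) = t -> t ^+ (p ^ (d * s)) = t.
  by move=> fix_t; elim: (s) => [|j IHj];
    rewrite ?muln0 // mulnS expnD exprM fix_t.
have [z] := chain_congr_expn (d * s) eq_xy.
rewrite !iter_fix // => def_xy; apply/eqP; rewrite -subr_eq0 def_xy.
have le_s : (s <= (d * s).+1)%N by rewrite leqW // leq_pmull.
by rewrite -(subnK le_s) exprD ps0 mulr0 mul0r.
Qed.

Lemma chain_torsion (x : B) : p%:R * x = 0 -> exists z, x = p%:R ^+ s.-1 * z.
Proof.
case: (chB) => _ ps0 tor px0.
have [->|/chain_valuation[k [u [ltks def_x u_neq0]]]] := eqVneq x 0.
  by exists 0; rewrite mulr0.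
have [ltk|lek] := ltnP k.+1 s.
  have /(tor _ _ ltk)/eqP : p%:R ^+ k.+1 * u = 0 by rewrite exprS -mulrA -def_x.
  by rewrite (negPf u_neq0).
have -> : s.-1 = k by apply: succn_inj; rewrite (ltn_predK ltks); apply/eqP;
  rewrite eqn_leq lek ltks.
by exists u.
Qed.

End ChainRing.

(** * Teichmuller representatives and the Frobenius map *)

Section Teichmuller.
Variables (p s d n : nat) (B : comNzRingType) (K : finFieldType).
Variables (rho : {rmorphism B -> K}) (chB : chain_residue p s rho).
Variable xi : B.
Hypotheses (d_gt0 : (0 < d)%N) (def_pd : n.+1 = (p ^ d)%N).
Hypotheses (xi_prim : n.-primitive_root xi) (leKn : (#|K| <= n.+1)%N).

Lemma teichmuller_expn (t : option 'I_n) :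
  teichmuller xi t ^+ n.+1 = teichmuller xi t.
Proof.
case: t => [i|] /=; last by rewrite expr0n.
by rewrite exprSr -exprM mulnC exprM (prim_expr_order xi_prim) expr1n mul1r.
Qed.

Lemma residue_prim_root_neq0 i : rho (xi ^+ i) != 0.
Proof.
apply/eqP=> xi_i0; have /eqP[] := oner_neq0 K; rewrite -(rmorph1 rho).
rewrite -(expr1n _ i) -(prim_expr_order xi_prim) exprAC rmorphXn /= xi_i0.
by rewrite expr0n eqn0Ngt (prim_order_gt0 xi_prim).
Qed.

Lemma teichmuller_residue_inj :
  injective (fun t : option 'I_n => rho (teichmuller xi t)).
Proof.
move=> t1 t2 /(chain_fixed_expn_inj chB d_gt0).
rewrite -def_pd !teichmuller_expn => /(_ erefl erefl).
case: t1 t2 => [i|] [j|] //= eq_ij.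
- by congr Some; apply/val_inj/eqP; move/eqP: eq_ij;
    rewrite (eq_prim_root_expr xi_prim) !modn_small.
- by have /eqP[] := residue_prim_root_neq0 i; rewrite eq_ij rmorph0.
- by have /eqP[] := residue_prim_root_neq0 j; rewrite -eq_ij rmorph0.
Qed.

(** The [n + 1] Teichmuller elements have distinct residues, which turns the bound [leKn] into an
    equality. *)
Lemma card_residue_field : #|K| = n.+1.
Proof.
apply/eqP; rewrite eqn_leq leKn -[n in (n < _)%N]card_ord -card_option.
by rewrite -(card_codom teichmuller_residue_inj) max_card.
Qed.

Lemma teichmuller_residue_surj (y : K) :
  exists t : option 'I_n, rho (teichmuller xi t) = y.
Proof.
have [|t ->] := codomP (inj_card_onto teichmuller_residue_inj _ y).
  by rewrite card_option card_ord.
by exists t.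
Qed.

(** At each step the remainder [z] becomes the Teichmuller element of the same residue plus a
    multiple of [p]; for [k = s] the last term vanishes. *)
Lemma teichmuller_expansion k (c : B) : exists (t : nat -> option 'I_n) z,
  c = \sum_(i < k) p%:R ^+ i * teichmuller xi (t i) + p%:R ^+ k * z.
Proof.
elim: k => [|k [t [z def_c]]].
  by exists (fun=> None), c; rewrite big_ord0 add0r mul1r.
have [t0 t0z] := teichmuller_residue_surj (rho z).
have [kerP _ _] := chB.
have /kerP[w def_w] : rho (z - teichmuller xi t0) = 0.
  by rewrite rmorphB /= t0z subrr.
exists (fun i => if (i < k)%N then t i else t0), w.
rewrite big_ord_recr /= ltnn {1}def_c exprSr -mulrA -def_w mulrBr addrA.
rewrite [RHS]addrAC addrK; congr (_ + _).
by apply: eq_bigr => i _; rewrite ltn_ord.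
Qed.

Lemma padic_repr_exists (c : B) :
  exists t : {ffun 'I_s -> option 'I_n}, padic_repr p xi c t.
Proof.
have [_ ps0 _] := chB; have [t [z def_c]] := teichmuller_expansion s c.
exists [ffun i : 'I_s => t i]; apply/eqP.
rewrite {1}def_c ps0 mul0r addr0.
by apply: eq_bigr => i _; rewrite ffunE.
Qed.

(** * Ring endomorphisms lifting the [q]-th power map, and the relative trace *)

Section Frobenius.
Variables (q m : nat) (phi : {rmorphism B -> B}).
Hypotheses (def_n : n.+1 = (q ^ m)%N).
Hypothesis phi_mod : forall c, rho (phi c) = rho c ^+ q.

(** Both sides are fixed by the power [n + 1 = p^d] and have the same residue. *)
Lemma lift_teichmuller (t : option 'I_n) :
  phi (teichmuller xi t) = teichmuller xi t ^+ q.
Proof.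
apply: (chain_fixed_expn_inj chB d_gt0); rewrite -?def_pd.
- by rewrite -rmorphXn /= teichmuller_expn.
- by rewrite exprAC teichmuller_expn.
- by rewrite phi_mod rmorphXn.
Qed.

(* phi takes the same value on every representation of c, so the choice made
   by pick is immaterial. *)
Lemma frobenius_lift : frobenius p s q n xi =1 phi.
Proof.
move=> c; rewrite /frobenius; case: pickP => [t /eqP def_c|no_repr].
  rewrite def_c rmorph_sum; apply: eq_bigr => i _.
  by rewrite rmorphM rmorphXn rmorph_nat lift_teichmuller.
by have [t] := padic_repr_exists c; rewrite no_repr.
Qed.

Lemma iter_lift_mod k c : rho (iter k phi c) = rho c ^+ (q ^ k).
Proof. by elim: k => //= k IHk; rewrite phi_mod IHk expnSr exprM. Qed.

(** On Teichmuller elements the iterate is the power [q^m = n + 1], which fixes them; it also fixes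
    [p], hence every [p]-adic expansion. *)
Lemma iter_lift_order c : iter m phi c = c.
Proof.
have iterM k a b : iter k phi (a * b) = iter k phi a * iter k phi b.
  by elim: k => //= k ->; rewrite rmorphM.
have [_ ps0 _] := chB; have [t [z def_c]] := teichmuller_expansion s c.
rewrite {}def_c ps0 mul0r addr0.
have fix_t (u : option 'I_n) : iter m phi (teichmuller xi u) = teichmuller xi u.
  rewrite -[RHS]teichmuller_expn def_n; elim: (m) => //= k ->.
  by rewrite rmorphXn /= lift_teichmuller -exprM expnS.
have fix_p j : iter m phi (p%:R ^+ j) = p%:R ^+ j.
  by elim: (m) => //= k ->; rewrite rmorphXn rmorph_nat.
rewrite (big_morph (iter m phi) (id1 := 0) (op1 := +%R)).
- by apply: eq_bigr => i _; rewrite iterM fix_p fix_t.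
- by move=> a b; elim: (m) => //= k ->; rewrite rmorphD.
- by elim: (m) => //= k ->; rewrite rmorph0.
Qed.

Notation T := (trace p s q n m xi).

Lemma trace_lift c : T c = \sum_(i < m) iter i phi c.
Proof. by apply: eq_bigr => i _; apply: eq_iter; apply: frobenius_lift. Qed.

Lemma traceD : {morph T : a b / a + b}.
Proof.
move=> a b; rewrite !trace_lift -big_split; apply: eq_bigr => i _ /=.
by elim: (nat_of_ord i) => //= k ->; rewrite rmorphD.
Qed.

Lemma trace0 : T 0 = 0.
Proof. by apply: (addrI (T 0)); rewrite -traceD !addr0. Qed.

Lemma trace_sum I (e : seq I) (f : I -> B) :
  T (\sum_(i <- e) f i) = \sum_(i <- e) T (f i).
Proof. exact: (big_morph T traceD trace0). Qed.

Lemma traceM_fixed a c : phi a = a -> T (a * c) = a * T c.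
Proof.
move=> fix_a; rewrite !trace_lift mulr_sumr; apply: eq_bigr => i _.
by elim: (nat_of_ord i) => //= k ->; rewrite rmorphM fix_a.
Qed.

Lemma trace_fixed c : phi (T c) = T c.
Proof.
rewrite !trace_lift rmorph_sum /=.
case: m (iter_lift_order c) => [|k] /= iter_c.
  by rewrite !big_ord0.
(* [phi] shifts the summands cyclically, the last one returning to [c]. *)
by rewrite big_ord_recr /= iter_c addrC [RHS]big_ord_recl.
Qed.

Lemma residue_trace c : rho (T c) = \sum_(i < m) rho c ^+ (q ^ i).
Proof.
by rewrite trace_lift rmorph_sum; apply: eq_bigr => i _; apply: iter_lift_mod.
Qed.

Lemma trace_nondegenerate lambda : (1 < q)%N -> (0 < m)%N ->
  (forall i : 'I_n, T (lambda * xi ^+ i) = 0) -> lambda = 0.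
Proof.
move=> q_gt1 m_gt0 T0; have [_ ps0 tor] := chB.
(* The [p]-adic digits of [c] are 0 or powers of [xi], and [T] commutes with multiplication by
   powers of [p]. *)
have Tc0 c : T (lambda * c) = 0.
  have [t [z ->]] := teichmuller_expansion s c.
  rewrite ps0 mul0r addr0 mulr_sumr trace_sum big1 // => i _.
  rewrite mulrCA traceM_fixed ?rmorphXn ?rmorph_nat //.
  by case: (t i) => [j|] /=; rewrite ?T0 ?mulr0 ?trace0 ?mulr0.
apply/eqP/contraT => /(chain_valuation chB)[k [u [ltks def_l u_neq0]]].
(* [P] is the trace modulo [p]. Since [u] is invertible modulo [p], [P] would vanish on all [q^m]
   elements of [K], although its degree is only [q^(m-1)]. *)
pose P : {poly K} := \sum_(i < m) 'X^(q ^ i).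
have P0 y : root P y.
  have [t def_y] := teichmuller_residue_surj (y / rho u).
  apply/eqP; have := Tc0 (teichmuller xi t).
  rewrite def_l -mulrA traceM_fixed ?rmorphXn ?rmorph_nat // => /(tor _ _ ltks).
  rewrite residue_trace rmorphM /= def_y mulrC divfK // => <-.
  by rewrite horner_sum; apply: eq_bigr => i _; rewrite hornerXn.
have P_neq0 : P != 0.
  apply/eqP => /(congr1 (coefp 1)); rewrite /coefp coef0 coef_sum.
  rewrite -(prednK m_gt0) big_ord_recl coefXn eqxx big1 ?addr0 => [|i _].
    by move/eqP; rewrite oner_eq0.
  by rewrite coefXn ltn_eqF // -{1}(expn0 q) ltn_exp2l.
have all_root : all (root P) (enum K) by apply/allP.
have := max_poly_roots P_neq0 all_root (enum_uniq K).
rewrite -cardE card_residue_field def_n ltnNge => /negP[].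
apply: leq_trans (size_sum _ _ _) _; apply/bigmax_leqP => i _.
by rewrite size_polyXn ltn_exp2l.
Qed.

(* Successive approximation: an element fixed modulo p^k comes from A modulo
   p^k. *)
Lemma lift_fixed (A : pzRingType) (iota : {rmorphism A -> B}) c :
    (forall a, phi (iota a) = iota a) ->
    (forall y, y ^+ q = y -> exists a, rho (iota a) = y) ->
  phi c = c -> exists a, c = iota a.
Proof.
move=> fix_iota iota_res fix_c; have [kerP ps0 _] := chB.
suff approx k : (k <= s)%N -> forall b w, phi b - b = p%:R ^+ k * w ->
    exists a z, b = iota a + p%:R ^+ k * z.
  have [|a [z def_c]] := approx s (leqnn s) c 0.
    by rewrite fix_c subrr mulr0.
  by exists a; rewrite def_c ps0 mul0r addr0.
elim: k => [|k IHk] lt_ks b w def_b.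
  by exists 0, b; rewrite rmorph0 add0r mul1r.
have [|a res_a] := iota_res (rho b).
  rewrite -phi_mod; apply/eqP; rewrite -subr_eq0 -rmorphB def_b.
  by rewrite exprS -mulrA rmorphM /= (chain_residue_p chB) mul0r.
have /kerP[b1 def_b1] : rho (b - iota a) = 0 by rewrite rmorphB /= res_a subrr.
have def_b' : b = iota a + p%:R * b1 by rewrite -def_b1 addrC subrK.
have phi_b : phi b - b = p%:R * (phi b1 - b1).
  rewrite {}def_b' rmorphD rmorphM rmorph_nat fix_iota opprD addrACA subrr.
  by rewrite add0r mulrBr.
(* Cancelling [p] costs an error in [p^(s-1) B]; as [k <= s - 1], it is absorbed in the multiple of
   [p^k] and the induction applies to [b1]. *)
have [|y def_y] := @chain_torsion _ _ _ _ _ chB (phi b1 - b1 - p%:R ^+ k * w).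
  by rewrite mulrBr mulrA -exprS -def_b phi_b subrr.
have [|a1 [z def_b1']] := IHk (ltnW lt_ks) b1 (w + p%:R ^+ (s.-1 - k) * y).
  rewrite mulrDr mulrA -exprD subnKC; last by rewrite -ltnS (ltn_predK lt_ks).
  by rewrite -def_y [RHS]addrC subrK.
exists (a + p%:R * a1), z.
rewrite {1}def_b' def_b1' rmorphD rmorphM rmorph_nat mulrDr addrA exprS.
by rewrite mulrA.
Qed.

End Frobenius.
End Teichmuller.

(** * Galois rings as quotients of polynomial rings *)

Lemma qpoly_lift (A B : comNzRingType) (h : {poly A})
    (G : {rmorphism {poly A} -> B}) :
    h \is monic -> (1 < size h)%N -> G h = 0 ->
  {f : {rmorphism {poly %/ h} -> B} | forall c, f c = G c}.
Proof.
move=> h_monic h_gt1 Gh0; pose f (c : {poly %/ h}) := G c.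
have Gmod u : G (Pdiv.CommonRing.rmodp u (mk_monic h)) = G u.
  rewrite /mk_monic h_gt1 h_monic /=.
  rewrite [in RHS](Pdiv.RingMonic.rdivp_eq h_monic u).
  by rewrite rmorphD rmorphM Gh0 mulr0 add0r.
have fD : zmod_morphism f by move=> a b; rewrite /f raddfB.
have fM : monoid_morphism f.
  by split=> [|a b]; [apply: rmorph1 | rewrite /f -rmorphM /= Gmod].
pose fAM := GRing.isZmodMorphism.Build _ _ f fD.
pose fMM := GRing.isMonoidMorphism.Build _ _ f fM.
pose F : {rmorphism {poly %/ h} -> B} := HB.pack f fAM fMM.
by exists F.
Qed.

Lemma root_qpolyX (A : comNzRingType) (h : {poly A}) (c : {poly %/ h}) :
  (map_poly (qpolyC h) c).['qX] = c.
Proof.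
rewrite -in_qpoly_comp_horner comp_polyXr; apply/val_inj/in_qpoly_small.
exact: size_mk_monic.
Qed.

(** For [i < s] the characteristic makes [p^i] nonzero, so whatever it kills is a zero divisor and
    lies in [pL]. *)
Lemma galois_ring_chain_residue (p s r : nat) (L : finComNzRingType)
    (F : finFieldType) (pi : {rmorphism L -> F}) :
  galois_ring p s r L -> residue_map p pi -> chain_residue p s pi.
Proof.
case=> p_prime char_L _ zdivP [_ kerP]; split=> //.
  by apply/eqP; rewrite -natrX char_L.
move=> i x lt_is px0; apply/kerP/zdivP.
exists (p%:R ^+ i); last by rewrite mulrC.
rewrite -natrX char_L; apply/negP => /dvdn_leq.
rewrite expn_gt0 prime_gt0 // leq_exp2l ?prime_gt1 // leqNgt lt_is.
by move/(_ isT).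
Qed.

(* As 'X^n - 1 = a h is separable mod p, a does not vanish mod p at a root of h
   mod p; since a.[y] * h.[y] = 0, h vanishes at y. *)
Lemma chain_lift_root (p s : nat) (B : comNzRingType) (K : fieldType)
    (rho : {rmorphism B -> K}) (n : nat) (a h : {poly B}) (y : B) :
    chain_residue p s rho -> 'X^n - 1 = a * h -> rho n%:R != 0 -> y ^+ n = 1 ->
  rho h.[y] = 0 -> h.[y] = 0.
Proof.
move=> chB def_ah n_neq0 yn1 rho_hy.
apply: (chain_regular chB (x := a.[y])); last first.
  by rewrite -hornerM -def_ah !hornerE yn1 subrr.
apply: contraNneq n_neq0 => rho_ay.
(* The derivative of ['X^n - 1] times ['X] takes the value [n] at [y], while both terms of the
   product rule vanish there modulo [p]. *)
have /(congr1 (fun f => rho (f.[y] * y))) := congr1 (@deriv B) def_ah.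
rewrite derivB derivXn derivC subr0 derivM !hornerE.
rewrite [in RHS]rmorphM rmorphD !rmorphM /= rho_hy rho_ay mulr0 mul0r add0r.
rewrite mul0r -rmorphM => <-.
rewrite hornerMn hornerXn mulrnAl -exprSr.
case: n yn1 {def_ah} => [|n] yn1; first by rewrite !mulr0n.
by rewrite yn1.
Qed.

(** Over [F], ['X^#|F| - 'X] splits into linear factors, so its roots in [K] are images of elements
    of [F]. *)
Lemma expr_card_image (F : finFieldType) (K : fieldType)
    (f : {rmorphism F -> K}) (y : K) : y ^+ #|F| = y -> exists x, y = f x.
Proof.
move=> fix_y; have := congr1 (fun P => (map_poly f P).[y]) (finField_genPoly F).
rewrite rmorphB /= map_polyXn map_polyX !hornerE fix_y subrr rmorph_prod.
rewrite horner_prod => /esym/eqP/prodf_eq0[x _].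
rewrite rmorphB /= map_polyX map_polyC !hornerE subr_eq0 => /eqP->.
by exists x.
Qed.

Lemma frobenius_expn (p q : nat) (K : fieldType) : p \in [pchar K] ->
  p.-nat q -> {morph (fun x : K => x ^+ q) : x y / x + y}.
Proof.
move=> chK p_q x y; apply: exprDn_pchar.
by rewrite (eq_pnat _ (pcharf_eq chK)).
Qed.

(** * Reduction of [L[x]/(h)] modulo [p] *)

Section ResidueField.
Variables (p s : nat) (L : comNzRingType) (F : finFieldType).
Variables (pi : {rmorphism L -> F}) (chL : chain_residue p s pi).
Variables (h : {poly L}) (h_monic : h \is monic) (h_gt1 : (1 < size h)%N).
Hypothesis hI : monic_irreducible_poly (map_poly pi h).
Notation K := {poly %/ (map_poly pi h) with hI}.

(** Representatives are shorter than [h], whose size survives reduction, so the kernel can be read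
    off coefficients; the chain conditions are then inherited from [L] coefficientwise. *)
Lemma qpoly_residue : {rho : {rmorphism {poly %/ h} -> K} |
  chain_residue p s rho &
  forall c, rho c = in_qpoly (map_poly pi h) (map_poly pi c)}.
Proof.
have [kerP ps0 tor] := chL.
pose G : {rmorphism {poly L} -> {poly %/ (map_poly pi h)}} :=
  in_qpoly (map_poly pi h) \o map_poly pi.
have mkE : mk_monic (map_poly pi h) = map_poly pi h by apply: mk_monicE.
have [|rho rhoE] := @qpoly_lift _ _ h G h_monic h_gt1.
  by apply: val_inj; rewrite /= mkE; apply: Pdiv.RingMonic.rmodpp; case: hI.
exists rho => //.
have rho0 c : rho c = 0 <-> forall i, pi c`_i = 0.
  have small : (size (map_poly pi c) < size (mk_monic (map_poly pi h)))%N.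
    rewrite mkE [X in (_ < X)%N]size_map_poly_id0; last first.
      by rewrite (monicP h_monic) rmorph1 oner_neq0.
    rewrite map_polyE; apply: leq_ltn_trans (size_Poly _) _; rewrite size_map.
    by rewrite (leq_trans (size_mk_monic c)) // /mk_monic h_gt1 h_monic.
  rewrite rhoE; split=> [c0 i | c0].
    by rewrite -coef_map -(in_qpoly_small small) [in_qpoly _ _]c0 coef0.
  apply/val_inj; rewrite [LHS]in_qpoly_small //.
  by apply/polyP=> i; rewrite coef_map /= c0 coef0.
have coefMp k (c : {poly %/ h}) i : (p%:R ^+ k * c)`_i = p%:R ^+ k * c`_i.
  by rewrite -!natrX !mulr_natl raddfMn coefMn.
split.
- move=> c; split=> [/rho0 c0 | [z ->]].
    have ex_z i : exists z, c`_i == p%:R * z.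
      by have /kerP[z ->] := c0 i; exists z.
    exists (in_qpoly h (\poly_(i < size c) xchoose (ex_z i))).
    apply/val_inj/polyP=> i; rewrite -[p%:R]expr1 coefMp.
    rewrite in_qpoly_small; last first.
      exact: leq_ltn_trans (size_poly _ _) (size_mk_monic c).
    rewrite coef_poly; case: ltnP => [_|le_ci].
      exact/eqP/(xchooseP (ex_z i)).
    by rewrite mulr0 nth_default.
  by apply/rho0=> i; rewrite -[p%:R]expr1 coefMp; apply/kerP; exists z`_i.
- by apply/val_inj/polyP=> i; rewrite -[_ ^+ _]mulr1 coefMp ps0 mul0r coef0.
- move=> i c lt_is pc0; apply/rho0=> j; apply: (tor i) => //.
  by rewrite -coefMp pc0 coef0.
Qed.
End ResidueField.

(** * The Frobenius lift and the trace of the Galois ring [L[x]/(h)] *)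

Section TraceProperties.
Variables (p s r q m n : nat).
Hypotheses (r_ge1 : (1 <= r)%N) (m_gt0 : (0 < m)%N).
Hypotheses (def_q : q = (p ^ r)%N) (def_n : n = (q ^ m - 1)%N).
Hypothesis qm_gt2 : (2 < q ^ m)%N.
Variables (L : finComNzRingType) (galL : galois_ring p s r L).
Variables (F : finFieldType) (pi : {rmorphism L -> F}).
Hypothesis resF : residue_map p pi.
Variable h : {poly L}.
Hypotheses (prim_h : basic_primitive pi h) (deg_h : size h = m.+1).
Hypothesis h_dvd : exists a : {poly L}, 'X^n - 1 = a * h.
Variables (xi : {poly %/ h}) (xi_root : root (map_poly (qpolyC h) h) xi).
Hypothesis xi_prim : n.-primitive_root xi.
Notation T := (trace p s q n m xi).

Let n1 : n.+1 = (q ^ m)%N.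
Proof. by rewrite def_n subn1 prednK // (ltn_trans _ qm_gt2). Qed.

Let n_gt1 : (1 < n)%N.
Proof. by rewrite -ltnS n1. Qed.

Let d_gt0 : (0 < r * m)%N.
Proof. by rewrite muln_gt0 r_ge1. Qed.

Let def_pd : n.+1 = (p ^ (r * m))%N.
Proof. by rewrite n1 def_q expnM. Qed.

Let q_gt1 : (1 < q)%N.
Proof.
by have [p_prime _ _ _] := galL; rewrite def_q -(expn0 p) ltn_exp2l ?prime_gt1.
Qed.

Let h_gt1 : (1 < size h)%N.
Proof. by rewrite deg_h ltnS. Qed.

Let h_monic : h \is monic. Proof. by case: prim_h. Qed.

Let chL : chain_residue p s pi.
Proof. exact: galois_ring_chain_residue galL resF. Qed.

Let size_pih : size (map_poly pi h) = m.+1.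
Proof. by rewrite size_map_poly_id0 ?(monicP h_monic) ?rmorph1 ?oner_neq0. Qed.

Lemma basic_primitive_irreducible : monic_irreducible_poly (map_poly pi h).
Proof. by case: prim_h => _ /primitive_polyP[]. Qed.
Notation hI := basic_primitive_irreducible.
Notation K := {poly %/ (map_poly pi h) with hI}.

(** The primitive polynomial [h] mod [p] divides no ['X^k - 1] with [0 < k < #|K| - 1], yet it
    divides ['X^n - 1]. *)
Lemma card_residue_le : (#|{: K}| <= n.+1)%N.
Proof.
have [_ /primitive_polyP[_ _ min_n]] := prim_h.
rewrite leqNgt; apply/negP=> lt_nK.
have := min_n n; rewrite -[#|_|.-1]/(#|{: K}|.-1) ltn_predRL lt_nK.
rewrite (ltn_trans _ n_gt1) // => /(_ isT)/negP[].
have [a def_a] := h_dvd.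
have := congr1 (map_poly pi) def_a.
by rewrite rmorphB rmorph1 rmorphM /= map_polyXn => ->; apply: dvdp_mull.
Qed.

Let rho := s2val (qpoly_residue chL h_monic h_gt1 hI).
Let chR : chain_residue p s rho.
Proof. exact: s2valP. Qed.
Let rhoE c : rho c = in_qpoly (map_poly pi h) (map_poly pi c).
Proof. by rewrite /rho; case: qpoly_residue. Qed.

Let cardK : #|{: K}| = n.+1.
Proof.
exact: (card_residue_field chR d_gt0 def_pd xi_prim card_residue_le).
Qed.

(** Compare [#|K| = #|F|^m] with [#|K| = q^m]. *)
Lemma card_base_field : #|F| = q.
Proof.
apply/eqP; rewrite -(eqn_exp2r _ _ m_gt0) -n1 -cardK card_qfpoly.
by rewrite size_pih.
Qed.

Let iotaK : {rmorphism F -> K} := qpolyC (map_poly pi h).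

Lemma residue_qpolyC a : rho (qpolyC h a) = iotaK (pi a).
Proof.
rewrite rhoE /= map_polyC /=; apply/val_inj/in_qpoly_small.
by rewrite (leq_ltn_trans (size_polyC_leq1 _)) ?size_mk_monic_gt1.
Qed.

Let K_pchar : p \in [pchar K].
Proof.
have [p_prime _ _ _] := galL; rewrite inE p_prime /=.
by rewrite -(rmorph_nat rho) (chain_residue_p chR).
Qed.

Let q_pnat : p.-nat q.
Proof.
by have [p_prime _ _ _] := galL; rewrite def_q pnatX pnat_id.
Qed.

(** In [K] the [q]-th power is additive and fixes the coefficients, which come from [F]. *)
Lemma residue_horner_expn (f : {poly L}) (y : {poly %/ h}) :
  rho (map_poly (qpolyC h) f).[y ^+ q] = rho (map_poly (qpolyC h) f).[y] ^+ q.
Proof.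
have qm := frobenius_expn K_pchar q_pnat.
rewrite -[f]coefK poly_def !rmorph_sum /= !horner_sum !rmorph_sum /=.
rewrite (big_morph _ qm (_ : _ = 0)) ?expr0n ?eqn0Ngt ?(ltnW q_gt1) //.
apply: eq_bigr => i _; rewrite map_polyZ map_polyXn !hornerE /=.
rewrite !rmorphM /= exprMn -!rmorphXn exprAC residue_qpolyC; congr (_ * _).
by rewrite [RHS]residue_qpolyC rmorphXn /= -card_base_field expf_card.
Qed.

Let rho_n_neq0 : rho n%:R != 0.
Proof.
have : rho n.+1%:R = 0.
  rewrite def_pd natrX rmorphXn /= (chain_residue_p chR) expr0n.
  by rewrite eqn0Ngt d_gt0.
rewrite -natr1 rmorphD rmorph1 => /eqP; rewrite addr_eq0 => /eqP->.
by rewrite oppr_eq0 oner_neq0.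
Qed.

(** The class [theta] of the indeterminate is sent to [theta ^+ q], a root of [h] modulo [p] and an
    [n]-th root of unity, hence a true root by [chain_lift_root]. *)
Lemma frobenius_morphism : exists2 phi : {rmorphism {poly %/ h} -> {poly %/ h}},
  forall a, phi (qpolyC h a) = qpolyC h a & forall c, rho (phi c) = rho c ^+ q.
Proof.
pose theta : {poly %/ h} := 'qX; pose hR := map_poly (qpolyC h) h.
have theta0 : hR.[theta] = 0.
  rewrite -in_qpoly_comp_horner comp_polyXr; apply/val_inj.
  by rewrite /= /mk_monic h_gt1 h_monic; apply: Pdiv.RingMonic.rmodpp.
have [a def_a] := h_dvd.
have def_aR : 'X^n - 1 = map_poly (qpolyC h) a * hR.
  by rewrite -rmorphM /= -def_a rmorphB rmorph1 /= map_polyXn.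
have theta_n : theta ^+ n = 1.
  have := congr1 (horner^~ theta) def_aR.
  by rewrite !hornerE theta0 mulr0 => /eqP; rewrite subr_eq0 => /eqP.
have thetaq0 : hR.[theta ^+ q] = 0.
  apply: (chain_lift_root chR def_aR rho_n_neq0).
    by rewrite exprAC theta_n expr1n.
  by rewrite residue_horner_expn theta0 rmorph0 expr0n eqn0Ngt (ltnW q_gt1).
pose comm_theta (x : L) : GRing.comm (theta ^+ q) (qpolyC h x) := mulrC _ _.
have [phi phiE] :=
  qpoly_lift (G := horner_morph comm_theta) h_monic h_gt1 thetaq0.
exists phi => [b | c]; rewrite phiE; first exact: horner_morphC.
(* [c] is the value at [theta] of its own representative. *)
by rewrite -[in RHS](root_qpolyX c) -residue_horner_expn.
Qed.

Lemma trace_add : {morph T : a b / a + b}.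
Proof.
have [phi _ phi_mod] := frobenius_morphism.
exact: (traceD chR d_gt0 def_pd xi_prim card_residue_le m phi_mod).
Qed.

Lemma trace_scalar a c : T (qpolyC h a * c) = qpolyC h a * T c.
Proof.
have [phi phi_a phi_mod] := frobenius_morphism.
exact: (traceM_fixed chR d_gt0 def_pd xi_prim card_residue_le m phi_mod).
Qed.

(** Traces are fixed by [phi]. Modulo [p], elements fixed by the [q]-th power lie in [F] and lift to
    [L], so [lift_fixed] applies. *)
Lemma trace_in_base c : exists a, T c = qpolyC h a.
Proof.
have [phi phi_a phi_mod] := frobenius_morphism.
apply: (lift_fixed chR phi_mod (iota := qpolyC h) phi_a); last first.
  exact: (trace_fixed chR d_gt0 def_pd xi_prim card_residue_le n1 phi_mod).
move=> y; rewrite -card_base_field.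
case/(expr_card_image iotaK) => x ->.
by have [[a <-] _] := (resF.1 x, 0%N); exists a; rewrite residue_qpolyC.
Qed.

Lemma trace_separates lambda :
  (forall i : 'I_n, T (lambda * xi ^+ i) = 0) -> lambda = 0.
Proof.
have [phi _ phi_mod] := frobenius_morphism.
exact: (trace_nondegenerate chR d_gt0 def_pd xi_prim card_residue_le n1 phi_mod
          q_gt1).
Qed.

Let rho_xi_neq1 : rho xi != 1.
Proof.
apply/eqP=> xi1; have := @teichmuller_residue_inj _ _ _ _ _ _ _ chR _ d_gt0
  def_pd xi_prim (Some (Ordinal (ltnW n_gt1))) (Some (Ordinal n_gt1)).
by rewrite /= !rmorph1 xi1 => /(_ erefl).
Qed.

Lemma prim_root_sub1_regular c : (xi - 1) * c = 0 -> c = 0.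
Proof.
by apply: (chain_regular chR); rewrite rmorphB rmorph1 subr_eq0.
Qed.

(** If [h.[1]] vanished modulo [p], irreducibility would make [h] mod [p] associate to ['X - 1],
    forcing [xi] to reduce to 1. So [h.[1]] is regular and the cofactor of [h] vanishes at 1. *)
Lemma XsubC1_mul_dvd : exists e, 'X^n - 1 = e * (('X - 1) * h).
Proof.
have [a def_a] := h_dvd.
have h1_neq0 : pi h.[1] != 0.
  apply: contra_neq rho_xi_neq1 => h1; apply/eqP; rewrite -subr_eq0.
  have [[_ irr_h] _] := hI.
  have dvd_h : 'X - 1%:P %| map_poly pi h.
    by rewrite dvdp_XsubCl /root -(rmorph1 pi) horner_map h1.
  have eqp_h : 'X - 1%:P %= map_poly pi h by apply: irr_h; rewrite ?size_XsubC.
  have /dvdpP[b def_b] : map_poly pi h %| 'X - 1%:P.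
    by rewrite (eqp_dvdr _ eqp_h).
  have map_h :
      map_poly iotaK (map_poly pi h) = map_poly rho (map_poly (qpolyC h) h).
    rewrite -!map_poly_comp; apply: eq_map_poly => x.
    by rewrite /= residue_qpolyC.
  have := congr1 (fun f => (map_poly iotaK f).[rho xi]) def_b.
  rewrite rmorphB rmorphM /= map_polyX map_polyC map_h !hornerE horner_map.
  by rewrite (eqP xi_root) rmorph0 mulr0 => ->.
have a1 : a.[1] = 0.
  apply: (chain_regular chL h1_neq0).
  by rewrite mulrC -hornerM -def_a !hornerE expr1n subrr.
have [/eqP/factor_theorem[e def_e]] := a1.
by exists e; rewrite mulrA -[1 in RHS]polyC1 -def_e.
Qed.

End TraceProperties.

(** * Reciprocal polynomials and cyclic codes *)

(** Reversal is taken relative to a bound [d] instead of the actual degree, which makes it additive;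
    it is the reciprocal when [size a = d.+1]. *)
Definition rev_poly (A : nzRingType) (d : nat) (a : {poly A}) : {poly A} :=
  \poly_(i < d.+1) a`_(d - i).

Section ReversePoly.
Variable A : comNzRingType.
Implicit Types a b : {poly A}.

Lemma rev_polyE d a : rev_poly d a = \sum_(i < d.+1) a`_i *: 'X^(d - i).
Proof.
rewrite /rev_poly poly_def (reindex_inj rev_ord_inj); apply: eq_bigr => i _ /=.
by rewrite subSS subKn // -ltnS.
Qed.

Lemma rev_polyB d a b : rev_poly d (a - b) = rev_poly d a - rev_poly d b.
Proof.
by apply/polyP=> i; rewrite coefB !coef_poly coefB; case: ifP; rewrite ?subrr.
Qed.

Lemma rev_poly_sum d I (e : seq I) (f : I -> {poly A}) :
  rev_poly d (\sum_(i <- e) f i) = \sum_(i <- e) rev_poly d (f i).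
Proof.
apply: (big_morph (@rev_poly A d)) => [a b|].
  by apply/polyP=> i; rewrite coefD !coef_poly coefD; case: ifP; rewrite ?addr0.
by apply/polyP=> i; rewrite coef_poly !coef0; case: ifP.
Qed.

Lemma rev_polyZXn d (c : A) k :
  (k <= d)%N -> rev_poly d (c *: 'X^k) = c *: 'X^(d - k).
Proof.
move=> le_kd; apply/polyP=> i; rewrite coef_poly !coefZ !coefXn.
case: ltnP => [lt_id|le_di]; first by congr (_ * _%:R); lia.
by rewrite (_ : (i == d - k)%N = false) ?mulr0 //; lia.
Qed.

(** By bilinearity this reduces to monomials, where [(d + e) - (i + j) = (d - i) + (e - j)]. *)
Lemma rev_polyM d e a b : (size a <= d.+1)%N -> (size b <= e.+1)%N ->
  rev_poly (d + e) (a * b) = rev_poly d a * rev_poly e b.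
Proof.
move=> le_ad le_be.
have trunc k (c : {poly A}) : (size c <= k)%N -> c = \sum_(i < k) c`_i *: 'X^i.
  move=> le_ck; rewrite -poly_def; apply/polyP=> i; rewrite coef_poly.
  by case: ltnP => // le_ki; rewrite nth_default // (leq_trans le_ck).
rewrite {1}(trunc _ _ le_ad) {1}(trunc _ _ le_be) (rev_polyE d a).
rewrite (rev_polyE e b) mulr_suml rev_poly_sum mulr_suml; apply: eq_bigr => i _.
rewrite !mulr_sumr rev_poly_sum; apply: eq_bigr => j _.
rewrite -!scalerAl -!scalerAr !scalerA -!exprD rev_polyZXn; last first.
  by rewrite leq_add // -ltnS.
by congr (_ *: 'X^_); have := ltn_ord i; have := ltn_ord j; lia.
Qed.

Lemma horner_rev_poly d a (x y : A) : (size a <= d.+1)%N -> x * y = 1 ->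
  (rev_poly d a).[y] = y ^+ d * a.[x].
Proof.
move=> le_ad xy1; rewrite rev_polyE horner_sum (horner_coef_wide _ le_ad).
rewrite mulr_sumr; apply: eq_bigr => i _; rewrite hornerZ hornerXn [RHS]mulrCA.
have -> : y ^+ d = y ^+ (d - i) * y ^+ i by rewrite -exprD subnK // -ltnS.
by rewrite -mulrA -exprMn [y * x]mulrC xy1 expr1n mulr1.
Qed.

(** The reversal has the root [y = 1/x], and ['X - y = y (x 'X - 1)] turns the geometric sum into
    [(x 'X)^n - 1 = 'X^n - 1]. *)
Lemma rev_poly_unity_root d n a (x y l : A) : (size a <= d.+1)%N -> root a x ->
    x * y = 1 -> x ^+ n = 1 ->
  exists w, rev_poly d a * \poly_(i < n) (l * x ^+ i) = w * ('X^n - 1).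
Proof.
move=> le_ad /eqP ax0 xy1 xn1.
have /factor_theorem[v ->] : root (rev_poly d a) y.
  by rewrite /root (horner_rev_poly le_ad xy1) ax0 mulr0.
exists (v * (l * y)%:P); rewrite -!mulrA; congr (_ * _).
have def_X : 'X - y%:P = y%:P * (x%:P * 'X - 1).
  by rewrite mulrBr mulrA -polyCM [y * x]mulrC xy1 mul1r mulr1.
have -> : \poly_(i < n) (l * x ^+ i) = l%:P * \sum_(i < n) (x%:P * 'X) ^+ i.
  rewrite poly_def mulr_sumr; apply: eq_bigr => i _.
  by rewrite exprMn -polyC_exp mulrA -polyCM mul_polyC.
rewrite def_X mulrACA -subrX1 exprMn -polyC_exp xn1 mul1r polyCM.
by rewrite [y%:P * _]mulrC.
Qed.

End ReversePoly.

Lemma in_qpoly_modP (A : comNzRingType) (h a b : {poly A}) :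
    h \is monic -> (1 < size h)%N ->
  (exists w, a = b + w * h) <-> in_qpoly h a = in_qpoly h b.
Proof.
move=> h_monic h_gt1.
have mkE : mk_monic h = h by rewrite /mk_monic h_gt1 h_monic.
split=> [[w ->] | /(congr1 (@polyn _ _)) /=].
  apply/val_inj; rewrite /= mkE Pdiv.RingMonic.rmodpD //.
  by rewrite Pdiv.RingMonic.rmodp_mull ?addr0.
rewrite mkE => eq_ab.
exists (Pdiv.Ring.rdivp a h - Pdiv.Ring.rdivp b h).
rewrite mulrBl addrA addrAC [b in b - _](Pdiv.RingMonic.rdivp_eq h_monic b).
rewrite [_ + _ - _]addrAC subrr add0r -eq_ab addrC.
exact: Pdiv.RingMonic.rdivp_eq.
Qed.

(** * Cyclic codes described by a check polynomial *)

Section CheckPolynomial.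
Variables (L : finComNzRingType) (n d : nat) (e H : {poly L}).
Hypotheses (n_gt0 : (0 < n)%N) (le_dn : (d <= n)%N).
Hypotheses (size_H : size H = d.+1) (size_e : (size e <= (n - d).+1)%N).
Hypothesis def_eH : 'X^n - 1 = e * H.
Notation g := (rev_poly (n - d) e).

(* e`_0 * H`_0 = -1, so this multiple of the reciprocal of H is monic. *)
Let Hrev := - e`_0 *: rev_poly d H.

Lemma rev_poly_cofactor : g * rev_poly d H = 1 - 'X^n.
Proof.
rewrite -rev_polyM ?size_H // subnK // -def_eH rev_polyB.
rewrite -['X^n]scale1r -[X in _ - rev_poly _ X](scale1r ('X^0)).
by rewrite !rev_polyZXn // subnn subn0 !scale1r.
Qed.

Let gHrev : g * Hrev = e`_0 *: ('X^n - 1).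
Proof. by rewrite -scalerAr rev_poly_cofactor scaleNr -scalerN opprB. Qed.

Let Hrev_d : Hrev`_d = 1.
Proof.
rewrite coefZ coef_poly ltnSn subnn mulNr -coef0M -def_eH.
by rewrite coefB coefXn coef1 (ltn_eqF n_gt0) sub0r opprK.
Qed.

Let size_Hrev : size Hrev = d.+1.
Proof.
apply/eqP; rewrite eqn_leq (leq_trans (size_scale_leq _ _) (size_poly _ _)) /=.
by rewrite ltnNge; apply/negP=> le_d; have /eqP := Hrev_d;
  rewrite nth_default // eq_sym oner_eq0.
Qed.

Let Hrev_monic : Hrev \is monic.
Proof. by rewrite monicE lead_coefE size_Hrev Hrev_d. Qed.

Let Xn1_gt1 : (1 < size ('X^n - 1 : {poly L})%R)%N.
Proof. by rewrite size_Xn_sub_1. Qed.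

(** Cancelling the monic [Hrev] gives [c = - w g] already in [L[x]]. *)
Lemma check_word (c : 'rV[L]_n) :
  (exists w, rVpoly c * rev_poly d H = w * ('X^n - 1)) -> c \in cyclic_code n g.
Proof.
case=> w cH; rewrite inE; apply/existsP; exists (in_qpoly ('X^n - 1) (- w)).
apply/eqP; rewrite -rmorphM; congr in_qpoly.
apply/eqP; rewrite -subr_eq0 mulNr opprK; apply/eqP.
apply: (monic_rreg Hrev_monic); rewrite mul0r mulrDl -mulrA gHrev.
by rewrite -!scalerAr cH scaleNr addNr.
Qed.

(** Modulo ['X^n - 1], a multiple [u g] depends only on the remainder of [u] by [Hrev], which has
    [d] coefficients. *)
Lemma card_cyclic_code : (#|cyclic_code n g| <= #|L| ^ d)%N.
Proof.
pose enc (v : 'rV[L]_d) : 'rV[L]_n :=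
  poly_rV (in_qpoly ('X^n - 1) (rVpoly v * g)).
have -> : (#|L| ^ d)%N = #|[set: 'rV[L]_d]| by rewrite cardsT card_mx mul1n.
apply: leq_trans (leq_imset_card enc _); apply/subset_leq_card/subsetP=> c.
rewrite inE => /existsP[u /eqP cu].
pose v := Pdiv.Ring.rmodp (polyn u) Hrev.
have size_v : (size v <= d)%N.
  by rewrite -ltnS -size_Hrev Pdiv.Ring.ltn_rmodpN0 ?monic_neq0.
apply/imsetP; exists (poly_rV v) => //.
rewrite /enc poly_rV_K //.
have -> : in_qpoly ('X^n - 1) (v * g) = in_qpoly ('X^n - 1) (rVpoly c).
  rewrite {}cu -[u in RHS](_ : in_qpoly _ (polyn u) = u); last first.
    by apply/val_inj/in_qpoly_small; apply: size_mk_monic.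
  rewrite -rmorphM; apply/esym/in_qpoly_modP => //; first exact: monic_Xn_sub_1.
  exists (Pdiv.Ring.rdivp (polyn u) Hrev * (e`_0)%:P).
  rewrite [polyn u in LHS](Pdiv.RingMonic.rdivp_eq Hrev_monic) -/v.
  rewrite mulrDl addrC -!mulrA; congr (_ + _ * _).
  by rewrite mulrC gHrev mul_polyC.
rewrite in_qpoly_small ?rVpolyK //.
rewrite /mk_monic Xn1_gt1 monic_Xn_sub_1 //= size_Xn_sub_1 // ltnS.
exact: size_poly.
Qed.

End CheckPolynomial.

(** * The trace description *)

Section TraceCode.
Variables (L : finComNzRingType) (n m : nat) (h e : {poly L}).
Hypotheses (n_gt0 : (0 < n)%N) (m_gt0 : (0 < m)%N).
Hypotheses (h_monic : h \is monic) (size_h : size h = m.+1).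
Hypothesis def_e : 'X^n - 1 = e * (('X - 1) * h).
Notation R := {poly %/ h}.
Variables (xi : R) (T : R -> R).
Hypotheses (xi_root : root (map_poly (qpolyC h) h) xi) (xi_n : xi ^+ n = 1).
Hypothesis xi1_regular : forall c, (xi - 1) * c = 0 -> c = 0.
Hypothesis T_add : {morph T : a b / a + b}.
Hypothesis T_scalar : forall a c, T (qpolyC h a * c) = qpolyC h a * T c.
Hypothesis T_base : forall c, exists a, T c = qpolyC h a.
Hypothesis T_separates :
  forall lambda, (forall i : 'I_n, T (lambda * xi ^+ i) = 0) -> lambda = 0.

Definition trace_word eps lambda : 'rV[R]_n :=
  const_mx (qpolyC h eps) + \row_(i < n) T (lambda * xi ^+ i).

Let T0 : T 0 = 0.
Proof. by apply: (addrI (T 0)); rewrite -T_add !addr0. Qed.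

Let T_sub a b : T (a - b) = T a - T b.
Proof. by apply: (addIr (T b)); rewrite -T_add !subrK. Qed.

Let T_sum I (s : seq I) (f : I -> R) :
  T (\sum_(i <- s) f i) = \sum_(i <- s) T (f i).
Proof. exact: (big_morph T T_add T0). Qed.

Let H := ('X - 1) * h.

Let H_monic : H \is monic.
Proof. by rewrite monicMl // -polyC1 monicXsubC. Qed.

Let size_H : size H = m.+2.
Proof.
rewrite size_monicM -?size_poly_eq0 ?size_h //.
  by rewrite -polyC1 size_XsubC.
by rewrite -polyC1 monicXsubC.
Qed.

Let e_gt0 : (0 < size e)%N.
Proof.
rewrite size_poly_gt0.
apply: contraTneq (monic_neq0 (monic_Xn_sub_1 L n_gt0)) => e0.
by rewrite def_e e0 mul0r eqxx.
Qed.

Let size_eH : (size e + m.+1)%N = n.+1.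
Proof.
have := congr1 (fun f : {poly L} => size f) def_e.
rewrite /= size_Xn_sub_1 // size_Mmonic -?size_poly_gt0 //.
by rewrite size_H addnS.
Qed.

Let le_mn : (m.+1 <= n)%N.
Proof. by move: size_eH e_gt0; lia. Qed.

Lemma kerdock_genE : kerdock_gen n h = rev_poly (n - m.+1) e.
Proof.
rewrite /kerdock_gen def_e Pdiv.RingMonic.rdivp_mull // /reciprocal /rev_poly.
by rewrite (_ : size e = (n - m.+1).+1) //; move: size_eH e_gt0; lia.
Qed.

(** For [lambda = lambda1 - lambda2], [T (lambda xi^i)] is constant in [i], so [T] kills every
    [(xi - 1) lambda xi^i]; separation and regularity of [xi - 1] give [lambda = 0]. *)
Lemma trace_word_inj eps1 eps2 lambda1 lambda2 :
    trace_word eps1 lambda1 = trace_word eps2 lambda2 ->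
  eps1 = eps2 /\ lambda1 = lambda2.
Proof.
move=> /matrixP eq_w; pose lambda := lambda1 - lambda2.
have T_const i : T (lambda * xi ^+ i) = qpolyC h (eps2 - eps1).
  (* Indices are read modulo [n], so that [i + 1] is also covered for [i = n - 1]. *)
  have := eq_w 0 (Ordinal (ltn_pmod i n_gt0)).
  rewrite !mxE /= expr_mod // mulrBl T_sub rmorphB => eq_wi.
  by rewrite -[T (lambda1 * _)](addKr (qpolyC h eps1)) eq_wi addrA addrK addrC.
have lambda0 : lambda = 0.
  apply/xi1_regular/T_separates=> i.
  by rewrite mulrBl mul1r mulrBl -mulrA mulrCA -exprS T_sub !T_const subrr.
split; last by apply/eqP; rewrite -subr_eq0 -/lambda lambda0.
have := T_const 0%N; rewrite lambda0 mul0r T0.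
move=> /esym/(congr1 (fun c : R => (polyn c)`_0)); rewrite /= coefC coef0 /=.
by move/eqP; rewrite subr_eq0 => /eqP.
Qed.

Local Notation inR := (map_poly (qpolyC h)).
Local Notation Tp := (map_poly T).

(** The check equation is proved over [R], where 1 and [xi] are roots of [H], and then descended to
    [L]. *)
Lemma trace_word_in_code eps lambda (c : 'rV[L]_n) :
  map_mx (qpolyC h) c = trace_word eps lambda -> c \in shortened_kerdock n h.
Proof.
move=> def_c; rewrite /shortened_kerdock kerdock_genE.
apply: (check_word n_gt0 le_mn size_H _ def_e); first by move: size_eH; lia.
pose P := rVpoly c.
have iH : inR (rev_poly m.+1 H) = rev_poly m.+1 (inR H).
  apply/polyP=> j; rewrite coef_map [(rev_poly _ H)`_j]coef_poly.
  rewrite [RHS]coef_poly coef_map.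
  by case: ifP; rewrite ?raddf0.
have le_iH : (size (inR H) <= m.+2)%N.
  by rewrite -size_H map_polyE (leq_trans (size_Poly _)) // size_map.
have i_Xn1 : inR ('X^n - 1) = 'X^n - 1 by rewrite rmorphB rmorph1 /= map_polyXn.
have root_H1 : root (inR H) 1.
  by rewrite rmorphM rmorphB rmorph1 /= map_polyX /root !hornerE subrr mul0r.
have root_Hxi : root (inR H) xi.
  by rewrite rmorphM /root hornerM (eqP xi_root) mulr0.
have [w1 def_w1] :=
  rev_poly_unity_root (qpolyC h eps) le_iH root_H1 (mulr1 1) (expr1n _ n).
have xiV : xi * xi ^+ n.-1 = 1 by rewrite -exprS prednK.
have [w2 def_w2] := rev_poly_unity_root lambda le_iH root_Hxi xiV xi_n.
(* T is L-linear, so applying it coefficientwise commutes with multiplication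
   by polynomials over L. *)
have TpM f u : Tp (inR f * u) = inR f * Tp u.
  apply/polyP=> j; rewrite coef_map_id0 // !coefM T_sum.
  by apply: eq_bigr => k _; rewrite coef_map T_scalar coef_map_id0.
have iP : inR P = \poly_(j < n) (qpolyC h eps * 1 ^+ j)
    + Tp (\poly_(j < n) (lambda * xi ^+ j)).
  apply/polyP=> j; rewrite coefD coef_map coef_map_id0 // !coef_poly.
  case: insubP => [k ->  <-|/negPf->]; last by rewrite T0 addr0 raddf0.
  by have /matrixP/(_ 0 k) := def_c; rewrite !mxE expr1n mulr1.
have iPH : inR (P * rev_poly m.+1 H) = (w1 + Tp w2) * ('X^n - 1).
  rewrite rmorphM /= iP iH mulrC mulrDr def_w1 -iH -TpM iH def_w2.
  by rewrite -i_Xn1 ![_ * inR _]mulrC TpM mulrDr.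
(* Descent: the remainder over [L] becomes over [R] a multiple of the monic ['X^n - 1] of smaller
   size, hence zero. *)
pose r := Pdiv.Ring.rmodp (P * rev_poly m.+1 H) ('X^n - 1).
pose w := Pdiv.Ring.rdivp (P * rev_poly m.+1 H) ('X^n - 1).
have Xn1_monic (A : nzRingType) : 'X^n - 1 \is @monic A.
  exact: monic_Xn_sub_1.
have def_PH : P * rev_poly m.+1 H = w * ('X^n - 1) + r.
  exact: (Pdiv.RingMonic.rdivp_eq (Xn1_monic L)).
suff r0 : r = 0 by exists w; rewrite def_PH r0 addr0.
apply: (@map_poly_div_inj _ h); rewrite rmorph0.
have ir : inR r = (w1 + Tp w2 - inR w) * ('X^n - 1).
  rewrite mulrBl -iPH def_PH rmorphD rmorphM /= i_Xn1 addrC.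
  by rewrite addKr.
have : (size (inR r) < size ('X^n - 1 : {poly R})%R)%N.
  rewrite size_Xn_sub_1 // map_polyE (leq_ltn_trans (size_Poly _)) // size_map.
  rewrite -(size_Xn_sub_1 L n_gt0).
  by rewrite Pdiv.Ring.ltn_rmodpN0 ?monic_neq0 ?Xn1_monic.
move/Pdiv.Ring.rmodp_small => <-.
by rewrite ir (Pdiv.RingMonic.rmodp_mull (Xn1_monic R)).
Qed.

Lemma trace_word_lift eps lambda :
  exists c : 'rV[L]_n, map_mx (qpolyC h) c = trace_word eps lambda.
Proof.
have /fin_all_exists[a T_a] (i : 'I_n) :
    exists b, T (lambda * xi ^+ i) = qpolyC h b.
  exact: T_base.
exists (\row_i (eps + a i)); apply/rowP=> i.
by rewrite !mxE rmorphD T_a.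
Qed.

Lemma shortened_kerdock_trace :
  extend_scalars h (shortened_kerdock n h)
    = [set trace_word eps lambda | eps : L, lambda : R].
Proof.
apply/esym/eqP; rewrite eqEcard; apply/andP; split.
  apply/subsetP=> _ /imset2P[eps lambda _ _ ->].
  have [c def_c] := trace_word_lift eps lambda.
  by apply/imsetP; exists c => //; apply: trace_word_in_code def_c.
apply: leq_trans (leq_imset_card _ _) _.
rewrite /shortened_kerdock kerdock_genE.
have size_e : (size e <= (n - m.+1).+1)%N by move: size_eH; lia.
apply: leq_trans (card_cyclic_code n_gt0 le_mn size_H size_e def_e) _.
(* Counting turns the inclusion into equality: distinct pairs give distinct trace words, and there
   are as many pairs as the code can have words. *)
have <- : #|{: L * R}| = (#|L| ^ m.+1)%N.
  by rewrite card_prod card_monic_qpoly ?size_h // expnS.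
have inj_w : injective (fun u : L * R => trace_word u.1 u.2).
  by case=> [e1 l1] [e2 l2] /trace_word_inj[/= -> ->].
rewrite -cardsT -(card_imset _ inj_w); apply/subset_leq_card/subsetP.
by move=> _ /imsetP[[eps lambda] _ ->]; apply/imset2P; exists eps lambda.
Qed.

(** [xi - 1] is regular and kills the sum of the powers of [xi], since [xi^n = 1]. *)
Lemma sum_trace_word lambda : \sum_(i < n) T (lambda * xi ^+ i) = 0.
Proof.
rewrite -T_sum -mulr_sumr (_ : \sum_(i < n) xi ^+ i = 0) ?mulr0 ?T0 //.
by apply: xi1_regular; rewrite -subrX1 xi_n subrr.
Qed.

Lemma kerdock_trace : n.+1%:R = 0 :> L ->
  extend_scalars h (kerdock n h)
    = [set const_mx (qpolyC h eps)
           + row_mx (0 : 'rV_1) (\row_(i < n) T (lambda * xi ^+ i))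
        | eps : L, lambda : R].
Proof.
move=> n1_0; have qpolyC_inj : injective (qpolyC h).
  by move=> a b /(congr1 (@polyn _ _)) /= /polyC_inj.
(* The trace part sums to 0 and [n = -1] in [L], so the parity coordinate must be [eps]. *)
have sum_c eps lambda (c : 'rV[L]_n) :
    map_mx (qpolyC h) c = trace_word eps lambda -> \sum_(i < n) c 0 i = - eps.
  move=> /matrixP def_c; apply: qpolyC_inj; rewrite rmorph_sum.
  have c_i i : qpolyC h (c 0 i) = qpolyC h eps + T (lambda * xi ^+ i).
    by have := def_c 0 i; rewrite !mxE.
  rewrite (eq_bigr _ (fun i _ => c_i i)) big_split /= sum_trace_word addr0.
  rewrite sumr_const card_ord /=.
  apply/eqP; rewrite rmorphN -addr_eq0 -mulrSr -rmorphMn -mulr_natl n1_0.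
  by rewrite mul0r rmorph0.
have code_trace := shortened_kerdock_trace.
apply/setP=> w; apply/imsetP/imset2P=> [[c c_in ->] | [eps lambda _ _ ->]].
  move: c_in; rewrite inE => /andP[c_in /eqP c_par].
  have : map_mx (qpolyC h) (rsubmx c)
      \in extend_scalars h (shortened_kerdock n h).
    by apply/imsetP; exists (rsubmx c).
  rewrite code_trace => /imset2P[eps lambda _ _ def_c].
  exists eps lambda => //; rewrite -[c in LHS]hsubmxK map_row_mx def_c.
  rewrite -row_mx_const add_row_mx addr0; congr row_mx.
  apply/matrixP=> i j; rewrite !ord1 !mxE; congr qpolyC.
  by move/eqP: c_par; rewrite (sum_c _ _ _ def_c) subr_eq0 mxE => /eqP.
have : trace_word eps lambda \in extend_scalars h (shortened_kerdock n h).
  by rewrite code_trace; apply/imset2P; exists eps lambda.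
case/imsetP=> c c_in /esym def_c; exists (row_mx (const_mx eps) c).
  by rewrite inE row_mxKr row_mxKl c_in (sum_c _ _ _ def_c) mxE subrr eqxx.
by rewrite map_row_mx def_c -row_mx_const add_row_mx addr0 map_const_mx.
Qed.

End TraceCode.

Theorem theorem6p1 (p s r q m n : nat)
  (s_ge1 : (1 <= s)%N) (r_ge1 : (1 <= r)%N) (m_gt0 : (0 < m)%N)
  (le_s_rm : (s <= r * m)%N)
  (def_q : q = (p ^ r)%N) (def_n : n = (q ^ m - 1)%N) (qm_gt2 : (2 < q ^ m)%N)
  (L : finComNzRingType) (galL : galois_ring p s r L)
  (F : finFieldType) (pi : {rmorphism L -> F}) (resF : residue_map p pi)
  (h : {poly L}) (prim_h : basic_primitive pi h) (deg_h : size h = m.+1)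
  (h_dvd : exists a : {poly L}, 'X^n - 1 = a * h)
  (xi : {poly %/ h}) (xi_root : root (map_poly (qpolyC h) h) xi)
  (xi_prim : n.-primitive_root xi) :
  extend_scalars h (shortened_kerdock n h)
    = [set const_mx (qpolyC h eps) + trace_row p s q n m xi lambda
        | eps : L, lambda : {poly %/ h}]
  /\
  extend_scalars h (kerdock n h)
    = [set const_mx (qpolyC h eps)
           + row_mx (0 : 'rV_1) (trace_row p s q n m xi lambda)
        | eps : L, lambda : {poly %/ h}].
Proof.
have n1 : n.+1 = (q ^ m)%N.
  by rewrite def_n subn1 prednK // (ltn_trans _ qm_gt2).
have n_gt0 : (0 < n)%N by rewrite -ltnS n1 (ltn_trans _ qm_gt2).
have [e def_e] := XsubC1_mul_dvd r_ge1 m_gt0 def_q def_n qm_gt2 galL resF prim_h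
  deg_h h_dvd xi_root xi_prim.
have h_monic : h \is monic by case: prim_h.
have xi1_regular := prim_root_sub1_regular r_ge1 m_gt0 def_q def_n qm_gt2 galL
  resF prim_h deg_h xi_prim.
have T_add := trace_add r_ge1 m_gt0 def_q def_n qm_gt2 galL resF prim_h deg_h
  h_dvd xi_prim.
have T_scalar := trace_scalar r_ge1 m_gt0 def_q def_n qm_gt2 galL resF prim_h
  deg_h h_dvd xi_prim.
have T_base := trace_in_base r_ge1 m_gt0 def_q def_n qm_gt2 galL resF prim_h
  deg_h h_dvd xi_prim.
have T_separates := trace_separates r_ge1 m_gt0 def_q def_n qm_gt2 galL resF
  prim_h deg_h h_dvd xi_prim.
have xi_n := prim_expr_order xi_prim.
(* Here [s <= r * m] enters: [p^s] divides [p^(r m) = n + 1]. *)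
have n1_0 : n.+1%:R = 0 :> L.
  have [_ char_L _ _] := galL.
  by apply/eqP; rewrite char_L n1 def_q -expnM dvdn_exp2l.
split.
  exact: (shortened_kerdock_trace n_gt0 m_gt0 h_monic deg_h def_e xi_root xi_n).
exact: (kerdock_trace n_gt0 m_gt0 h_monic deg_h def_e xi_root xi_n).
Qed.
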